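(* Consider the quasi-Lie scheme $S(W_{\rm Abel},V_{\rm Abel})$ with $V_{\rm Abel}=\langle Y_0,Y_1,Y_2,Y_3\rangle$, $W_{\rm Abel}=\langle Y_0,Y_1\rangle$, $Y_k=x^k\,\partial/\partial x$. Near a generic point of the twelve-dimensional manifold $T^2V_{\rm Abel}$ there exist at least four functionally independent local common first-integrals of the vector fields on $T^2V_{\rm Abel}$ characterising quasi-Lie invariants of order two (namely the fundamental vector fields of the actions $\mathcal{J}^2$, $\mathcal{T}^2$, $\mathcal{T}_2$ and the generators of the flows $\mathcal{T}_1^L$, $L\in W_{\rm Abel}$), i.e. four functionally independent (local) quasi-Lie invariants of order two of Abel equations. One of them is the Liouville invariant $\Phi_3^5/\Phi_5^3$, where, for an Abel equation $X=\sum_{k=0}^3A_k(t)Y_k$, $$\Phi_3=\frac{dA_3}{dt}A_2-A_3\frac{dA_2}{dt}-3A_0A_3^2+A_1A_2A_3-\frac 29A_2^3,$$ $$\Phi_5=-A_3\frac{d\Phi_3}{dt}-3\left(-\frac{dA_3}{dt}+\frac 13A_2^2-A_1A_3\right)\Phi_3 .$$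
   Context: Points of $T^2V_{\rm Abel}\simeq V_{\rm Abel}^3\simeq\mathbb{R}^{12}$ are second-order tangent vectors ${\bf t}^2_{t}X=(X_t,\dot X_t,\ddot X_t)$ of curves $t\mapsto X_t=\sum_kA_k(t)Y_k$ in $V_{\rm Abel}$, with coordinates $(A_k,\dot A_k,\ddot A_k)_{k=0,\dots,3}$. Similarly, $T^2W_{\rm Abel}\simeq W_{\rm Abel}^3$. Write $W=W_{\rm Abel}$, $V=V_{\rm Abel}$, and let $G=\mathbb{R}\rtimes\mathbb{R}^+$ act on $\mathbb{R}$ by $(\beta,\alpha)\cdot x=\alpha x+\beta$. The actions on $T^2V$ are: $\mathcal{J}^2:(g;(X,Y,Z))\mapsto(g_*X,g_*Y,g_*Z)$ for $g\in G$; $\mathcal{T}^2:((0,0,L);(X,Y,Z))\mapsto(X,Y,Z+L)$ for $L\in W$; $\mathcal{T}_2:((0,L_1,L_2);(X,Y,Z))\mapsto(X,\,Y+L_1,\,Z+L_2-[L_1,X])$ for $L_1,L_2\in W$; $\mathcal{T}_1^L:(s;(X,Y,Z))\mapsto(X+sL,\,Y-s[L,X],\,Z+s^2[L,[L,X]]-2s[L,Y])$ for $s\in\mathbb{R}$, $L\in W$. A quasi-Lie invariant of order two is a map $F$ from the family $\mathcal{V}_{\rm Abel}$ of $t$-dependent vector fields with values in $V_{\rm Abel}$ to functions of $t$ of the form $[F(X)](t)=\varphi_F({\bf t}^2_tX)$ that is invariant under all $t$-dependent affine changes of variable $x=\alpha(t)\bar x+\beta(t)$ (with $\alpha(t)>0$);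 local ones correspond to functions $\varphi_F$ defined on an open subset of $T^2V_{\rm Abel}$ and annihilated by the generators of the actions $\mathcal{J}^2$, $\mathcal{T}^2$, $\mathcal{T}_2$ and $\mathcal{T}_1^L$ (for all $L\in W$). A first-integral of a vector field is a function annihilated by it. *)

(* Defs.v *)
From HB Require Import structures.
From mathcomp Require Import all_boot all_order all_algebra.
From mathcomp Require Import all_classical all_reals all_analysis.

Set Implicit Arguments.
Unset Strict Implicit.
Unset Printing Implicit Defensive.
Import Order.TTheory GRing.Theory Num.Theory.
Import numFieldNormedType.Exports.
Local Open Scope classical_set_scope.
Local Open Scope ring_scope.

(* The row vector (A_0, .., A_3) stands for the vector field
   \sum_k A_k Y_k = (\sum_k A_k x^k) d/dx, whose component is [rVpoly X]. *)
Notation Vabel R := 'rV[R]_4.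

(* (X, X', X'') *)
Notation T2V R := ('rV[R]_4 * 'rV[R]_4 * 'rV[R]_4)%type.

Definition Y {R : realType} (k : 'I_4) : Vabel R := delta_mx 0 k.

Definition Wabel {R : realType} : set (Vabel R) :=
  [set L | exists b0 b1 : R, L = b0 *: Y 0 + b1 *: Y 1].

(* [f d/dx, g d/dx] = (f g' - g f') d/dx *)
Definition lie {R : realType} (f g : {poly R}) : {poly R} :=
  f * g^`() - g * f^`().

(* [poly_rV] truncates at degree 3; on W x V nothing is lost, by [bracketE]. *)
Definition bracket {R : realType} (L X : Vabel R) : Vabel R :=
  poly_rV (lie (rVpoly L) (rVpoly X)).

(* For g = (beta, alpha), i.e. g.x = alpha x + beta, the component of g_* X at
   x is g'(g^-1 x) * X (g^-1 x) = alpha * X ((x - beta) / alpha). *)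
Definition push {R : realType} (g : R * R) (X : Vabel R) : Vabel R :=
  poly_rV (g.2 *: (rVpoly X \Po (g.2^-1 *: ('X - g.1%:P)))).

Section Sanity.
Variable R : realType.
Implicit Types (L X : Vabel R).

Lemma rVpoly_Wabel L : Wabel L ->
  exists b0 b1 : R, rVpoly L = b0%:P + b1 *: 'X.
Proof.
move=> [b0 [b1 ->]]; exists b0, b1.
by rewrite linearD !linearZ /= !rVpoly_delta /= expr0 alg_polyC expr1.
Qed.

Lemma bracketE L X : Wabel L ->
  rVpoly (bracket L X) = lie (rVpoly L) (rVpoly X).
Proof.
move=> /rVpoly_Wabel[b0 [b1 EL]]; rewrite /bracket poly_rV_K // /lie EL.
set p := rVpoly X; have sp : (size p <= 4)%N by exact: size_poly.
apply/leq_sizeP => k k4.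
have p0 m : (4 <= m)%N -> p`_m = 0 by move=> ?; apply: (leq_sizeP _ _ sp).
rewrite derivD derivZ derivC derivX add0r coefB mulrDl coefD coefCM.
rewrite -scalerAl coefZ coefXM -scalerAr mulr1 coefZ !coef_deriv.
by case: k k4 => // k k4; rewrite /= !p0 // ?mul0rn ?mulr0 ?addr0 ?subr0 // ltnW.
Qed.

Lemma pushE (g : R * R) X : g.2 != 0 ->
  rVpoly (push g X) = g.2 *: (rVpoly X \Po (g.2^-1 *: ('X - g.1%:P))).
Proof.
move=> a0; rewrite /push poly_rV_K // (leq_trans (size_scale_leq _ _)) //.
rewrite (leq_trans (size_comp_poly_leq _ _)) //.
rewrite size_scale ?invr_eq0 // size_XsubC muln1.
have : (size (rVpoly X) <= 4)%N by exact: size_poly.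
by case: (size _).
Qed.

End Sanity.

Section Actions.
Variable R : realType.

(* The group R x| R^+ is the half-plane 0 < g.2 of R * R, with unit (0, 1). *)
Definition J2 (g : R * R) (p : T2V R) : T2V R :=
  (push g p.1.1, push g p.1.2, push g p.2).

Definition T2up (L : Vabel R) (p : T2V R) : T2V R :=
  (p.1.1, p.1.2, p.2 + L).

Definition T2low (L : Vabel R * Vabel R) (p : T2V R) : T2V R :=
  (p.1.1, p.1.2 + L.1, p.2 + L.2 - bracket L.1 p.1.1).

Definition T1 (L : Vabel R) (s : R) (p : T2V R) : T2V R :=
  (p.1.1 + s *: L,
   p.1.2 - s *: bracket L p.1.1,
   p.2 + s ^+ 2 *: bracket L (bracket L p.1.1) - (2 * s) *: bracket L p.1.2).

(* Derivative at the unit e, in the direction xi, of the orbit map of p. *)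
Definition fundamental (M : normedModType R) (act : M -> T2V R -> T2V R)
    (e xi : M) : T2V R -> T2V R :=
  fun p => 'D_xi (fun g : M => act g p) e.

Inductive characterising_field : (T2V R -> T2V R) -> Prop :=
| char_J2 (xi : R * R) :
    characterising_field (fundamental J2 (0, 1) xi)
| char_T2up (L : Vabel R) : Wabel L ->
    characterising_field (fundamental T2up 0 L)
| char_T2low (L1 L2 : Vabel R) : Wabel L1 -> Wabel L2 ->
    characterising_field (fundamental T2low 0 (L1, L2))
| char_T1 (L : Vabel R) : Wabel L ->
    characterising_field (fundamental (T1 L) 0 1).

(* All iterated directional derivatives exist and are differentiable. *)
Definition smooth_on (O : set (T2V R)) (f : T2V R -> R) : Prop :=
  forall (vs : seq (T2V R)) (q : T2V R), O q ->
    differentiable (foldr (fun v (h : T2V R -> R) => 'D_v h) f vs) q.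

Definition first_integral (O : set (T2V R)) (v : T2V R -> T2V R)
    (f : T2V R -> R) : Prop :=
  forall q, O q -> 'D_(v q) f q = 0.

Definition local_quasi_Lie_invariant2 (O : set (T2V R)) (f : T2V R -> R) :=
  smooth_on O f /\
  forall v, characterising_field v -> first_integral O v f.

Definition functionally_independent (n : nat) (O : set (T2V R))
    (f : 'I_n -> T2V R -> R) : Prop :=
  forall q, O q -> forall c : 'I_n -> R,
    (forall v : T2V R, \sum_(i < n) c i * 'd (f i) q v = 0) ->
    forall i, c i = 0.

(* t-dependent vector fields with values in V *)
Definition smooth_curve (X : R -> Vabel R) : Prop :=
  forall n t, derivable (X^`(n))%classic t 1.

Definition jet2 (X : R -> Vabel R) (t : R) : T2V R :=
  (X t, X^`()%classic t, X^`(2)%classic t).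

Definition coefA (X : R -> Vabel R) (k : 'I_4) : R -> R := fun t => X t 0 k.

Definition Phi3 (X : R -> Vabel R) : R -> R := fun t =>
  let A k := coefA X k t in let dA k := (coefA X k)^`()%classic t in
  dA 3 * A 2 - A 3 * dA 2 - 3 * A 0 * A 3 ^+ 2 + A 1 * A 2 * A 3
    - 2 / 9 * A 2 ^+ 3.

Definition Phi5 (X : R -> Vabel R) : R -> R := fun t =>
  let A k := coefA X k t in let dA k := (coefA X k)^`()%classic t in
  - A 3 * (Phi3 X)^`()%classic t
    - 3 * (- dA 3 + 1 / 3 * A 2 ^+ 2 - A 1 * A 3) * Phi3 X t.

(* f represents the Liouville invariant on O: [F(X)](t) = f (jet2 X t).  Every
   point of O is the 2-jet of some smooth curve, so this determines f on O. *)
Definition represents_Liouville (O : set (T2V R)) (f : T2V R -> R) : Prop :=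
  forall X t, smooth_curve X -> O (jet2 X t) ->
    Phi5 X t != 0 /\ f (jet2 X t) = Phi3 X t ^+ 5 / Phi5 X t ^+ 3.

End Actions.

(* Main.v *)
(* By the shift x -> x - A_2 / (3 A_3) an Abel equation is brought to the form
   y' = A_3 y^3 + B_1 y + B_0 with B_0 = - Phi_3 / (3 A_3^2), which leaves only the
   scalings y -> alpha(t) y.  Here A_3 and B_0 have weights 2 and -1, and B_1 is the
   connection defining a covariant derivative D.  The second-order covariants
   A_3, D A_3, D^2 A_3, B_0, D B_0 yield four absolute invariants; the ones used are
     D A_3 / A_3,  D^2 A_3 / A_3,  Phi_3^2 / A_3^3  and  Phi_3^5 / Phi_5^3,
   with Phi_5 = 3 Phi_3 D A_3 - A_3 D Phi_3.  All are rational, so smoothness, the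
   invariance equations and the Jacobian reduce to polynomial identities on the
   dense open set A_3 Phi_3 Phi_5 != 0. *)

From HB Require Import structures.
Require Import Defs.
From mathcomp Require Import all_boot all_order all_algebra.
From mathcomp Require Import all_classical all_reals all_analysis.
From mathcomp Require Import ring.
Import Order.TTheory GRing.Theory Num.Theory.
Import numFieldNormedType.Exports.
Local Open Scope classical_set_scope.
Local Open Scope ring_scope.

(** * Formal calculus of rational functions *)

Lemma near_eq_differentiable {R : realType} {V W : normedModType R}
    (f g : V -> W) (x : V) :
  {near x, f =1 g} -> differentiable f x -> differentiable g x.
Proof.
move=> fg df.
(* The first-order expansion of [f] at [x] is also one of [g]; uniqueness of the differential then
   identifies that of [g]. *)
have gE : g \o shift x = cst (g x) + 'd f x +o_ 0 id.
  have gx : f x = g x := nbhs_singleton fg.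
  have fg0 : \forall h \near (0 : V), f (h + x) = g (h + x).
    by move: fg; rewrite (near_shift 0) /= subr0.
  have /eqaddoP fo := diff_locally df.
  apply/eqaddoP => e e0; move: fg0 (fo e e0); apply: filterS2 => h /= fgh.
  by rewrite !fctE /= fgh gx.
have cf : continuous ('d f x) by exact: diff_continuous.
by apply/diff_locallyP; rewrite (diff_unique cf gE).
Qed.

Section Rational.
Context {R : realType} {V : normedModType R}.

(* Nothing forces the argument of [rLin] to be a linear form: [rwd] does. *)
Inductive rexpr : Type :=
| rLin of V -> R
| rCst of R
| rAdd of rexpr & rexpr
| rMul of rexpr & rexpr
| rInv of rexpr.

Fixpoint reval (e : rexpr) (x : V) : R :=
  match e with
  | rLin l => l x
  | rCst c => c
  | rAdd e1 e2 => reval e1 x + reval e2 x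
  | rMul e1 e2 => reval e1 x * reval e2 x
  | rInv e1 => (reval e1 x)^-1
  end.

Fixpoint rder (v : V) (e : rexpr) : rexpr :=
  match e with
  | rLin l => rCst (l v)
  | rCst _ => rCst 0
  | rAdd e1 e2 => rAdd (rder v e1) (rder v e2)
  | rMul e1 e2 => rAdd (rMul e1 (rder v e2)) (rMul e2 (rder v e1))
  | rInv e1 => rMul (rCst (-1)) (rMul (rMul (rInv e1) (rInv e1)) (rder v e1))
  end.

Fixpoint rwd (x : V) (e : rexpr) : Prop :=
  match e with
  | rLin l => forall y, is_diff y l l
  | rCst _ => True
  | rAdd e1 e2 | rMul e1 e2 => rwd x e1 /\ rwd x e2
  | rInv e1 => rwd x e1 /\ reval e1 x != 0
  end.

(** Differentiation creates no new denominators: the derivative of [rInv e1] only inverts [e1]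
    again. Hence formal derivatives can be iterated wherever [e] is well defined. *)
Lemma rwd_rder v x e : rwd x e -> rwd x (rder v e).
Proof. by elim: e => //= [e1 h1 e2 h2 []|e1 h1 e2 h2 []|e1 h1 []]; tauto. Qed.

Lemma is_diff_reval x e : rwd x e -> is_diff x (reval e) (fun v => reval (rder v e) x).
Proof.
elim: e => //=.
- move=> c _; exact: is_diff_cst.
- move=> e1 h1 e2 h2 [/h1 {}h1 /h2 {}h2].
  exact: (is_diffD h1 h2).
- move=> e1 h1 e2 h2 [/h1 {}h1 /h2 {}h2].
  exact: (is_diffM h1 h2).
- move=> e1 h1 [/h1 [d1 d1E] n0]; apply: DiffDef.
    exact: differentiableV.
  rewrite diffV //; apply/funext => v /=.
  rewrite d1E -[LHS]/(- (reval e1 x ^+ 2)^-1 * reval (rder v e1) x).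
  by rewrite -exprVn mulN1r mulNr.
Qed.

Lemma derive_reval v x e : rwd x e -> 'D_v (reval e) x = reval (rder v e) x.
Proof. by move=> /is_diff_reval[de dE]; rewrite deriveE // dE. Qed.

End Rational.

(** By induction on the list of directions, the iterated derivative agrees on all of [O] with a
    single well-defined expression. Openness of [O] turns this into agreement near each point, which
    the next derivative and differentiability require. *)
Lemma smooth_on_reval {R : realType} (O : set (T2V R)) e :
  open O -> (forall q, O q -> rwd q e) -> smooth_on O (reval e).
Proof.
move=> oO wdO vs.
suff [e' wde' H] : exists2 e', (forall q, O q -> rwd q e') &
    forall q, O q -> foldr (fun v (h : T2V R -> R) => 'D_v h) (reval e) vs q = reval e' q.
  move=> q Oq; apply: near_eq_differentiable (is_diff_reval _ _ (wde' _ Oq)).(ex_diff).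
  by apply: filterS (open_nbhs_nbhs (conj oO Oq)) => z /H.
elim: vs => [|v vs [e' wde' IH]] /=; first by exists e.
exists (rder v e') => [q /wde'|q Oq]; first exact: rwd_rder.
rewrite -derive_reval; last exact: wde'.
apply: near_eq_derive.
by apply: filterS (open_nbhs_nbhs (conj oO Oq)) => z /IH.
Qed.

Fixpoint rPow {R : realType} {V : normedModType R} (e : @rexpr R V) n :=
  if n is n'.+1 then rMul e (rPow e n') else rCst 1.

Declare Scope rexpr_scope.
Delimit Scope rexpr_scope with RE.
Bind Scope rexpr_scope with rexpr.
Notation "c %:c" := (rCst c) (at level 2, format "c %:c") : rexpr_scope.
Notation "x + y" := (rAdd x y) : rexpr_scope.
Notation "x * y" := (rMul x y) : rexpr_scope.
Notation "- x" := (rMul (rCst (-1)) x) : rexpr_scope.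
Notation "x - y" := (x + - y)%RE : rexpr_scope.
Notation "x / y" := (rMul x (rInv y)) : rexpr_scope.
Notation "x ^+ n" := (rPow x n) : rexpr_scope.

(** * Derivatives of orbit maps and brackets, in coordinates *)

Lemma derive_line {R : realType} {M W : normedModType R} (F : M -> W) (e v : M) :
  'D_v F e = 'D_1 (fun h : R => F (h *: v + e)) 0.
Proof.
rewrite /derive; apply: (f_equal (fun u : R -> W => lim (u @ 0^'))).
apply/funext => h /=.
by rewrite addr0 scale0r add0r -[h *: 1]/(h * 1) mulr1.
Qed.

Section Coordinates.
Context {R : realType}.

Lemma differentiable_row {n} {M : normedModType R} (c : 'I_n -> M -> R) x :
  (forall k, differentiable (c k) x) -> differentiable (fun g => \row_k c k g) x.
Proof.
move=> dc.
have -> : (fun g => \row_k c k g) = \sum_k (fun g => c k g *: (delta_mx 0 k : 'rV[R]_n)).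
  by apply/funext => g; rewrite fct_sumE [LHS]row_sum_delta; apply: eq_bigr => k _; rewrite mxE.
by apply: differentiable_sum => k; exact: differentiableZl.
Qed.

Lemma diff_row {n} {M : normedModType R} (c : 'I_n -> rexpr) (x v : M) :
  (forall k, rwd x (c k)) ->
  'd (fun g => \row_k reval (c k) g) x v = \row_k reval (rder v (c k)) x.
Proof.
move=> wc; have dc : differentiable (fun g => \row_k reval (c k) g) x.
  by apply: differentiable_row => k; case: (is_diff_reval x _ (wc k)).
rewrite -deriveE // derive_mx; last exact: diff_derivable.
apply/rowP => k; rewrite !mxE -derive_reval //.
by congr ('D_v _ x); apply/funext => t; rewrite mxE.
Qed.

(** An orbit map is only differentiated along a line, so each coordinate is a rational expression in
    one real parameter [h] and can be differentiated formally at [h = 0]. *)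
Lemma derive_line_T2V {M : normedModType R} (F : M -> T2V R) (e v : M)
    (c0 c1 c2 : 'I_4 -> rexpr) :
  (forall k, [/\ rwd (0 : R) (c0 k), rwd (0 : R) (c1 k) & rwd (0 : R) (c2 k)]) ->
  (forall h k, [/\ (F (h *: v + e)).1.1 0 k = reval (c0 k) h,
                   (F (h *: v + e)).1.2 0 k = reval (c1 k) h &
                   (F (h *: v + e)).2 0 k = reval (c2 k) h]) ->
  'D_v F e = (\row_k reval (rder (1 : R) (c0 k)) 0, \row_k reval (rder (1 : R) (c1 k)) 0,
              \row_k reval (rder (1 : R) (c2 k)) 0).
Proof.
move=> wc Fc; rewrite derive_line.
have -> : (fun h => F (h *: v + e)) = (fun h => (\row_k reval (c0 k) h, \row_k reval (c1 k) h,
   \row_k reval (c2 k) h)).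
  apply/funext => h; case: (F _) (Fc h) => -[X Y] Z /= E.
  by congr (_, _, _); apply/rowP => k; rewrite mxE; case: (E k).
have d0 c : (forall k, rwd (0 : R) (c k)) ->
    differentiable (fun h => \row_(k < 4) reval (c k) h) (0 : R).
  by move=> w; apply: differentiable_row => k; case: (is_diff_reval (0 : R) _ (w k)).
have D0 : differentiable (fun h => \row_k reval (c0 k) h) (0 : R) by apply: d0 => k; case: (wc k).
have D1 : differentiable (fun h => \row_k reval (c1 k) h) (0 : R) by apply: d0 => k; case: (wc k).
have D2 : differentiable (fun h => \row_k reval (c2 k) h) (0 : R) by apply: d0 => k; case: (wc k).
rewrite deriveE; last by do 2?[apply: differentiable_pair].
have D01 := differentiable_pair D0 D1.
apply: etrans (congr1 (@^~ (1 : R)) (diff_pair D01 D2)) _.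
apply: f_equal2; last by apply: diff_row => k; case: (wc k).
apply: etrans (congr1 (@^~ (1 : R)) (diff_pair D0 D1)) _.
by apply: f_equal2; apply: diff_row => k; case: (wc k).
Qed.

Lemma Wabel_coef (L : Vabel R) : Wabel L -> rVpoly L = (L 0 0)%:P + L 0 1 *: 'X.
Proof.
move=> WL; have [b0 [b1 E]] := rVpoly_Wabel WL.
have := coef_rVpoly_ord L 0; have := coef_rVpoly_ord L 1.
rewrite E /= !coefD !coefC !coefZ !coefX /= mulr1 mulr0 addr0 add0r.
by move=> -> ->.
Qed.

(** For L = b0 Y_0 + b1 Y_1 one has [L, Y_m] = m b0 Y_(m-1) + (m - 1) b1 Y_m. The shifted
    coefficient is read off the polynomial because [k + 1] in ['I_4] would wrap around to 0 at
    [k = 3]. *)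
Lemma bracket_coef (L X : Vabel R) (k : 'I_4) : Wabel L ->
  bracket L X 0 k = L 0 0 * (rVpoly X)`_k.+1 * k.+1%:R + L 0 1 * X 0 k * (k%:R - 1).
Proof.
move=> WL; rewrite -coef_rVpoly_ord bracketE // /lie Wabel_coef //.
rewrite derivD derivZ derivC derivX add0r coefB mulrDl coefD coefCM.
rewrite -scalerAl coefZ coefXM -scalerAr mulr1 coefZ !coef_deriv coef_rVpoly_ord.
case: k => -[|k] k4 /=; first by rewrite mulr_natr !mulr0; ring.
rewrite -(coef_rVpoly_ord X) /= -[_ *+ k.+2]mulr_natr -[_ *+ k.+1]mulr_natr.
by rewrite mulrBr mulr1 addrA !mulrA.
Qed.

Lemma bracket_coefs (L X : Vabel R) : Wabel L ->
  [/\ bracket L X 0 0 = L 0 0 * X 0 1 - L 0 1 * X 0 0,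
      bracket L X 0 1 = 2 * L 0 0 * X 0 2,
      bracket L X 0 2 = 3 * L 0 0 * X 0 3 + L 0 1 * X 0 2 &
      bracket L X 0 3 = 2 * L 0 1 * X 0 3].
Proof.
move=> WL; rewrite !bracket_coef //=.
have c4 : (rVpoly X)`_4 = 0 by apply: (leq_sizeP _ _ (size_poly _ _)).
have c1 : (rVpoly X)`_1 = X 0 1 by rewrite -(coef_rVpoly_ord X 1).
have c2 : (rVpoly X)`_2 = X 0 2 by rewrite -(coef_rVpoly_ord X 2).
have c3 : (rVpoly X)`_3 = X 0 3 by rewrite -(coef_rVpoly_ord X 3).
have v1 : (1 %% 4 = 1)%N by []; have v2 : ((1 + 1) %% 4 = 2)%N by [].
have v3 : ((1 + 2) %% 4 = 3)%N by [].
by rewrite !(v1, v2, v3, c1, c2, c3, c4); split; ring.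
Qed.

End Coordinates.

(** * The characterising fields as infinitesimal gauge transformations *)

Lemma coef_exp_XaddC {R : comNzRingType} (c : R) m k :
  (('X + c%:P) ^+ m)`_k = c ^+ (m - k) *+ 'C(m, k).
Proof.
rewrite addrC exprDn coef_sum.
have [km|mk] := leqP k m; last first.
  (* For k > m the truncated exponent [m - k] is harmless, since the binomial coefficient
     vanishes. *)
  rewrite bin_small // mulr0n big1 // => -[i im] _ /=.
  rewrite coefMn -polyC_exp coefCM coefXn.
  by case: eqP => [E|_]; [move: mk; rewrite E ltnNge -ltnS im|rewrite mulr0 mul0rn].
rewrite (bigD1 (Ordinal (n:=m.+1) (m:=k) km)) //= big1 ?addr0.
  by rewrite coefMn -polyC_exp coefCM coefXn eqxx mulr1.
move=> [i im] /=; rewrite -val_eqE /= => ik.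
by rewrite coefMn -polyC_exp coefCM coefXn eq_sym (negbTE ik) mulr0 mul0rn.
Qed.

Section Fields.
Context {R : realType}.
Implicit Types (L X : Vabel R) (p q : T2V R).

(* Value at (X, X', X'') of the variation induced by an infinitesimal change of
   variable along a curve L(t) in W, where L_i is the i-th derivative of L at t:
   differentiate delta X = L' - [L, X] twice.  Each characterising field is the
   case where all L_i but one or two consecutive ones vanish. *)
Definition gauge_field (L0 L1 L2 L3 : Vabel R) (p : T2V R) : T2V R :=
  (L1 - bracket L0 p.1.1,
   L2 - bracket L1 p.1.1 - bracket L0 p.1.2,
   L3 - bracket L2 p.1.1 - 2 *: bracket L1 p.1.2 - bracket L0 p.2).

Lemma WabelZ (h : R) L : Wabel L -> Wabel (h *: L).
Proof.
by move=> [b0 [b1 ->]]; exists (h * b0), (h * b1); rewrite scalerDr !scalerA.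
Qed.

Lemma Wabel_coef23 L : Wabel L -> L 0 2 = 0 /\ L 0 3 = 0.
Proof. by move=> [b0 [b1 ->]]; rewrite !mxE /= !mulr0 addr0. Qed.

Lemma push_coef (g : R * R) X k : push g X 0 k =
  g.2 * \sum_(m < 4) X 0 m * (g.2^-1 ^+ m * ((- g.1) ^+ (m - k) *+ 'C(m, k))).
Proof.
rewrite /push !mxE coefZ; congr (_ * _).
have -> : rVpoly X = \sum_(m < 4) X 0 m *: 'X^m.
  rewrite [in LHS](row_sum_delta X) linear_sum; apply: eq_bigr => m _.
  by rewrite linearZ /= rVpoly_delta.
rewrite linear_sum coef_sum; apply: eq_bigr => m _ /=.
rewrite linearZ /= comp_Xn_poly coefZ exprZn coefZ; congr (_ * (_ * _)).
by rewrite -polyCN coef_exp_XaddC.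
Qed.

Lemma push_line (b a h : R) X k :
  push (h *: (b, a) + (0, 1)) X 0 k =
  (a * h + 1) * \sum_(m < 4) X 0 m * ((a * h + 1)^-1 ^+ m * ((- b * h) ^+ (m - k) *+ 'C(m, k))).
Proof.
rewrite push_coef /= addr0 -![h *: _]/(h * _) (mulrC h a).
by under eq_bigr do rewrite (mulrC h b) -mulNr.
Qed.

(* Keeping the powers of [rInv u] uncancelled makes [push_exprE] hold at u = 0 as
   well, where [push] is evaluated with the junk inverse 0. *)
Definition push_expr (b a : R) X (k : 'I_4) : @rexpr R R :=
  let u := (a%:c * rLin id + 1%:c)%RE in
  let t m := ((X 0 m)%:c * (rInv u ^+ m *
    (((- b)%:c * rLin id) ^+ (m - k) * ('C(m, k)%:R)%:c)))%RE in
  (u * (t 0 + t 1 + t 2 + t 3))%RE.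

Lemma reval_pow {V : normedModType R} (e : @rexpr R V) n x : reval (e ^+ n)%RE x = reval e x ^+ n.
Proof. by elim: n => //= n ->; rewrite exprS. Qed.

Lemma rwd_pow {V : normedModType R} (e : @rexpr R V) n x : rwd x e -> rwd x (e ^+ n)%RE.
Proof. by move=> we; elim: n => //=. Qed.

Lemma big_ord4 (F : 'I_4 -> R) : \sum_(m < 4) F m = F 0 + F 1 + F 2 + F 3.
Proof.
rewrite 4!big_ord_recr big_ord0 /= add0r.
by congr (F _ + F _ + F _ + F _); apply: val_inj.
Qed.

Lemma push_exprE (b a h : R) X k :
  push (h *: (b, a) + (0, 1)) X 0 k = reval (push_expr b a X k) h.
Proof.
rewrite push_line big_ord4; case: k => -[|[|[|[|//]]]] k4 /=; ring.
Qed.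

Lemma forall_ord4 (P : 'I_4 -> Prop) : P 0 -> P 1 -> P 2 -> P 3 -> forall k, P k.
Proof.
move=> P0 P1 P2 P3 [[|[|[|[|k]]]] k4] //.
- by have -> : Ordinal k4 = 0 by apply: val_inj.
- by have -> : Ordinal k4 = 1 by apply: val_inj.
- by have -> : Ordinal k4 = 2 by apply: val_inj.
- by have -> : Ordinal k4 = 3 by apply: val_inj.
Qed.

Lemma rwd_id (x : R) : rwd x (rLin id).
Proof. by move=> y; exact: is_diff_id. Qed.

Lemma rwd_push_expr (b a : R) X k : rwd (0 : R) (push_expr b a X k).
Proof.
have wid := rwd_id 0; have wb : rwd (0 : R) ((- b)%:c * rLin id)%RE by [].
(* At parameter 0 the curve passes through the group unit, so the scale factor is 1. *)
have wu : rwd (0 : R) (rInv (a%:c * rLin id + 1%:c)%RE).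
  by rewrite /= mulr0 add0r oner_eq0.
rewrite /push_expr; do !split => //; try exact: rwd_pow; try exact: wid; try by case: wu.
Qed.

Lemma Wabel_comb (b a : R) : Wabel (b *: Y 0 + a *: Y 1).
Proof. by exists b, a. Qed.

Lemma coef_comb (b a : R) : let L := b *: Y 0 + a *: Y 1 in L 0 0 = b /\ L 0 1 = a.
Proof. by move=> L; rewrite /L !mxE /= !mulr1 !mulr0 addr0 add0r. Qed.

(** The maps x -> (1 + a h) x + b h have velocity L = b Y_0 + a Y_1 at h = 0, and the pushforward
    along such a family has derivative -[L, X]. *)
Lemma rder_push_expr (b a : R) X k :
  reval (rder (1 : R) (push_expr b a X k)) (0 : R) = - bracket (b *: Y 0 + a *: Y 1) X 0 k.
Proof.
have := bracket_coefs _ X (Wabel_comb b a); have [-> ->] := coef_comb b a.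
case=> B0 B1 B2 B3.
have v1 : (1 %% 4 = 1)%N by []; have v2 : ((1 + 1) %% 4 = 2)%N by [].
have v3 : ((1 + 2) %% 4 = 3)%N by [].
have a1 : a * 0 + 1 = 1 by rewrite mulr0 add0r.
have C32 : 'C(3, 2) = 3 by [].
move: k; apply: forall_ord4;
  rewrite ?(B0, B1, B2, B3) /push_expr /= a1 invr1 ?(v1, v2, v3).
all: rewrite ?bin0 ?bin1 ?binn ?C32 ?[in 'C(1, _)]bin_small
  ?[in 'C(2, _)]bin_small ?[in 'C(0, _)]bin_small //.
all: ring.
Qed.
Lemma bracketZl (h : R) L X : Wabel L -> bracket (h *: L) X = h *: bracket L X.
Proof.
move=> WL; apply/rowP => k.
rewrite [in RHS]mxE !bracket_coef ?mxE //; last exact: WabelZ.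
ring.
Qed.

Lemma Wabel0 : Wabel (0 : Vabel R).
Proof. by exists 0, 0; rewrite !scale0r addr0. Qed.

Lemma bracket0l X : bracket 0 X = 0.
Proof. by rewrite -(scale0r (0 : Vabel R)) bracketZl ?scale0r //; exact: Wabel0. Qed.

Lemma fundamental_J2 (b a : R) p :
  fundamental (@J2 R) (0, 1) (b, a) p = gauge_field (b *: Y 0 + a *: Y 1) 0 0 0 p.
Proof.
rewrite /fundamental (@derive_line_T2V R _ _ _ _ (push_expr b a p.1.1)
  (push_expr b a p.1.2) (push_expr b a p.2)).
- rewrite /gauge_field !bracket0l scaler0 !subr0 !sub0r.
  by congr (_, _, _); apply/rowP => k; rewrite [LHS]mxE rder_push_expr [RHS]mxE.
- by move=> k; split; exact: rwd_push_expr.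
- by move=> h k; split; exact: push_exprE.
Qed.

Lemma fundamental_T2up L p :
  fundamental (@T2up R) 0 L p = gauge_field 0 0 0 L p.
Proof.
rewrite /fundamental (@derive_line_T2V R _ _ _ _ (fun k => rCst (p.1.1 0 k))
  (fun k => rCst (p.1.2 0 k)) (fun k => ((p.2 0 k)%:c + rLin id * (L 0 k)%:c)%RE)).
- rewrite /gauge_field !bracket0l scaler0 !subr0.
  by congr (_, _, _); apply/rowP => k; rewrite !mxE /=; ring.
- by move=> k; repeat first [exact: rwd_id | split].
- by move=> h k; rewrite /= addr0 !mxE.
Qed.

Lemma fundamental_T2low L1 L2 p : Wabel L1 ->
  fundamental (@T2low R) 0 (L1, L2) p = gauge_field 0 0 L1 L2 p.
Proof.
move=> W1; rewrite /fundamental (@derive_line_T2V R _ _ _ _ (fun k => rCst (p.1.1 0 k))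
  (fun k => ((p.1.2 0 k)%:c + rLin id * (L1 0 k)%:c)%RE)
  (fun k => ((p.2 0 k)%:c + rLin id * (L2 0 k - bracket L1 p.1.1 0 k)%:c)%RE)).
- rewrite /gauge_field !bracket0l scaler0 !subr0.
  move: (bracket _ _) => B; congr (_, _, _); apply/rowP => k; rewrite !mxE /=; ring.
- by move=> k; repeat first [exact: rwd_id | split].
- move=> h k; rewrite /= !addr0 bracketZl //.
  move: (bracket _ _) => B; rewrite !mxE; split; ring.
Qed.

(** The term in s^2 has zero derivative at s = 0; the terms linear in s are exactly those that L_1
    contributes to the gauge field. *)
Lemma fundamental_T1 L p :
  fundamental (T1 L) 0 1 p = gauge_field 0 L 0 0 p.
Proof.
rewrite /fundamental (@derive_line_T2V R _ _ _ _
  (fun k => ((p.1.1 0 k)%:c + rLin id * (L 0 k)%:c)%RE)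
  (fun k => ((p.1.2 0 k)%:c - rLin id * (bracket L p.1.1 0 k)%:c)%RE)
  (fun k => ((p.2 0 k)%:c + rLin id * rLin id * (bracket L (bracket L p.1.1) 0 k)%:c
     - 2%:c * rLin id * (bracket L p.1.2 0 k)%:c)%RE)).
- rewrite /gauge_field !bracket0l.
  move: (bracket L p.1.1) (bracket L p.1.2) (bracket L (bracket _ _)) => B1 B2 B0.
  congr (_, _, _); apply/rowP => k; rewrite !mxE /=; ring.
- by move=> k; repeat first [exact: rwd_id | split].
- move=> h k; rewrite /= !addr0 -[h *: 1]/(h * 1) mulr1.
  move: (bracket L p.1.1) (bracket L p.1.2) (bracket L (bracket _ _)) => B1 B2 B0.
  rewrite !mxE; split; ring.
Qed.

(** Invariance under the four families is thereby reduced to one computation, with L_0, .., L_3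
    arbitrary in W. *)
Lemma characterising_fieldE v : characterising_field v ->
  exists L0 L1 L2 L3 : Vabel R, [/\ Wabel L0, Wabel L1, Wabel L2 & Wabel L3] /\
    v = gauge_field L0 L1 L2 L3.
Proof.
have W0 := Wabel0.
case=> [[b a]|L WL|L1 L2 W1 W2|L WL].
- exists (b *: Y 0 + a *: Y 1), 0, 0, 0; split; last exact/funext/fundamental_J2.
  by split=> //; exact: Wabel_comb.
- by exists 0, 0, 0, L; split=> //; exact/funext/fundamental_T2up.
- by exists 0, 0, L1, L2; split=> //; apply/funext => p; exact: fundamental_T2low.
- by exists 0, L, 0, 0; split=> //; exact/funext/fundamental_T1.
Qed.

End Fields.

(** * Infinitesimal weights *)

Section Weights.
Context {R : realType} {V : normedModType R}.
Implicit Types (P Q : @rexpr R V) (v x : V).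

Definition weighted v x (w : R) P := reval (rder v P) x = w * reval P x.

Lemma rder_pow v x P n :
  reval (rder v (P ^+ n)%RE) x = n%:R * reval P x ^+ n.-1 * reval (rder v P) x.
Proof.
elim: n => [|n IH]; first by rewrite /= !mul0r.
rewrite /= IH reval_pow; case: n {IH} => [|n] /=; first by ring.
by rewrite !exprS -[n.+2]addn1 natrD; ring.
Qed.

Lemma rder_div v x P Q : reval Q x != 0 -> reval (rder v (P / Q)%RE) x =
  (reval (rder v P) x * reval Q x - reval P x * reval (rder v Q) x) / reval Q x ^+ 2.
Proof. by move=> Q0 /=; field. Qed.

Lemma weighted_pow v x w P n : weighted v x w P -> weighted v x (n%:R * w) (P ^+ n)%RE.
Proof.
rewrite /weighted rder_pow reval_pow => ->; case: n => [|n]; first by rewrite !mul0r.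
by rewrite exprS /=; ring.
Qed.

(** In the quotient rule the equal rates of scaling of numerator and denominator cancel. *)
Lemma weighted_div v x w P Q : reval Q x != 0 ->
  weighted v x w P -> weighted v x w Q -> reval (rder v (P / Q)%RE) x = 0.
Proof. by move=> Q0 wP wQ; rewrite rder_div // wP wQ; field. Qed.

End Weights.

(** * Covariants of Abel equations and their absolute invariants *)

Section Covariants.
Context {R : realType}.
Implicit Types (L X : Vabel R) (p q v : T2V R).

Definition cA k : rexpr := rLin (fun p : T2V R => p.1.1 0 k).
Definition cdA k : rexpr := rLin (fun p : T2V R => p.1.2 0 k).
Definition cddA k : rexpr := rLin (fun p : T2V R => p.2 0 k).

(* The shift x -> x - A_2 / (3 A_3) removes the quadratic term and turns A_1 into
   B_1 = A_1 - A_2^2 / (3 A_3), a connection for the scalings x -> alpha x: if u has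
   weight w then so does Du = u' + w B_1 u.  Powers of A_3 clear denominators. *)
Definition cA3B1 : rexpr := (cA 1 * cA 3 - (1 / 3)%:c * cA 2 ^+ 2)%RE.
Definition cDA3 : rexpr := (cdA 3 + 2%:c * cA3B1)%RE.
Definition cA3D2A3 : rexpr :=
  (cA 3 * (cddA 3 + 2%:c * (cdA 1 * cA 3 + cA 1 * cdA 3 - (2 / 3)%:c * cA 2 * cdA 2))
   + 2%:c * cA3B1 * cDA3)%RE.
Definition cPhi3 : rexpr :=
  (cdA 3 * cA 2 - cA 3 * cdA 2 - 3%:c * cA 0 * cA 3 ^+ 2 + cA 1 * cA 2 * cA 3
    - (2 / 9)%:c * cA 2 ^+ 3)%RE.
(** The total t-derivative of Phi_3, a function on T^2 V. Its direction of differentiation varies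
    with the point whereas [rder] takes a fixed one, so the product rule is written out;
    [derive1_Phi3] confirms it. *)
Definition cdPhi3 : rexpr :=
  (cddA 3 * cA 2 - cA 3 * cddA 2 - 3%:c * cdA 0 * cA 3 ^+ 2
    - 6%:c * cA 0 * cA 3 * cdA 3
    + cdA 1 * cA 2 * cA 3 + cA 1 * cdA 2 * cA 3 + cA 1 * cA 2 * cdA 3
    - (2 / 3)%:c * cA 2 ^+ 2 * cdA 2)%RE.
Definition cPhi5 : rexpr :=
  (- cA 3 * cdPhi3 - 3%:c * (- cdA 3 + (1 / 3)%:c * cA 2 ^+ 2 - cA 1 * cA 3) * cPhi3)%RE.

Lemma is_diff_linear {M W : normedModType R} (l : {linear M -> W}) x :
  continuous l -> is_diff x l l.
Proof. by move=> cl; apply: DiffDef; [exact: linear_differentiable|exact: diff_lin]. Qed.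

Lemma is_diff_fst {M W : normedModType R} (x : M * W) : is_diff x fst fst.
Proof. by apply: (is_diff_linear fst) => y; exact: cvg_fst. Qed.

Lemma is_diff_snd {M W : normedModType R} (x : M * W) : is_diff x snd snd.
Proof. by apply: (is_diff_linear snd) => y; exact: cvg_snd. Qed.

Lemma is_diff_coord n k (X : 'rV[R]_n) :
  is_diff X (fun Z : 'rV[R]_n => Z 0 k) (fun Z : 'rV[R]_n => Z 0 k).
Proof.
have lk : linear (fun X : 'rV[R]_n => X 0 k : R^o) by move=> c Y Z; rewrite !mxE.
pose L : {linear _ -> _} := HB.pack (fun X : 'rV[R]_n => X 0 k : R^o)
  (GRing.isLinear.Build _ _ _ _ _ lk).
by apply: (is_diff_linear L); exact: coord_continuous.
Qed.

Lemma rwd_coord k q : [/\ rwd q (cA k), rwd q (cdA k) & rwd q (cddA k)].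
Proof.
split=> y /=.
- exact: (is_diff_comp (is_diff_comp (is_diff_fst y) (is_diff_fst y.1)) (is_diff_coord _ k y.1.1)).
- exact: (is_diff_comp (is_diff_comp (is_diff_fst y) (is_diff_snd y.1)) (is_diff_coord _ k y.1.2)).
- exact: (is_diff_comp (is_diff_snd y) (is_diff_coord _ k y.2)).
Qed.

Lemma gauge_coef L0 L1 L2 L3 q k : let v := gauge_field L0 L1 L2 L3 q in
  [/\ v.1.1 0 k = L1 0 k - bracket L0 q.1.1 0 k,
      v.1.2 0 k = L2 0 k - bracket L1 q.1.1 0 k - bracket L0 q.1.2 0 k &
      v.2 0 k = L3 0 k - bracket L2 q.1.1 0 k - 2 * bracket L1 q.1.2 0 k
                - bracket L0 q.2 0 k].
Proof.
rewrite /gauge_field /=.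
move: (bracket L0 q.1.1) (bracket L1 q.1.1) (bracket L0 q.1.2) (bracket L2 q.1.1)
  (bracket L1 q.1.2) (bracket L0 q.2) => B1 B2 B3 B4 B5 B6.
by rewrite !mxE.
Qed.

(** Covariance means that translations and the derivatives L_1, L_2, L_3 drop out, leaving only the
    scaling rate [L0 0 1]. The sign in [l] comes from the pushforward: x -> alpha x multiplies A_3
    by alpha^(-2). *)
Lemma gauge_weights L0 L1 L2 L3 q : Wabel L0 -> Wabel L1 -> Wabel L2 -> Wabel L3 ->
  let v := gauge_field L0 L1 L2 L3 q in let l := - L0 0 1 in
  [/\ weighted v q (2 * l) (cA 3), weighted v q (2 * l) cDA3, weighted v q (4 * l) cA3D2A3,
      weighted v q (3 * l) cPhi3 & weighted v q (5 * l) cPhi5].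
Proof.
move=> W0 W1 W2 W3 v l.
have [b00 b01 b02 b03] := bracket_coefs L0 q.1.1 W0.
have [b10 b11 b12 b13] := bracket_coefs L1 q.1.1 W1.
have [b20 b21 b22 b23] := bracket_coefs L2 q.1.1 W2.
have [c00 c01 c02 c03] := bracket_coefs L0 q.1.2 W0.
have [c10 c11 c12 c13] := bracket_coefs L1 q.1.2 W1.
have [d00 d01 d02 d03] := bracket_coefs L0 q.2 W0.
(* Elements of W have only components 0 and 1; after this substitution each weight equation is a
   polynomial identity in the coordinates. *)
have [l02 l03] := Wabel_coef23 _ W0; have [l12 l13] := Wabel_coef23 _ W1.
have [l22 l23] := Wabel_coef23 _ W2; have [l32 l33] := Wabel_coef23 _ W3.
have [A0 dA0 ddA0] := gauge_coef L0 L1 L2 L3 q 0.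
have [A1 dA1 ddA1] := gauge_coef L0 L1 L2 L3 q 1.
have [A2 dA2 ddA2] := gauge_coef L0 L1 L2 L3 q 2.
have [A3 dA3 ddA3] := gauge_coef L0 L1 L2 L3 q 3.
rewrite -/v in A0 dA0 ddA0 A1 dA1 ddA1 A2 dA2 ddA2 A3 dA3 ddA3.
rewrite ?(b00, b01, b02, b03, c00, c01, c02, c03, d00, d01, d02, d03, b10, b11, b12, b13,
 b20, b21, b22, b23, c10, c11, c12, c13, l02, l03, l12, l13, l22, l23, l32, l33)
 in A0 dA0 ddA0 A1 dA1 ddA1 A2 dA2 ddA2 A3 dA3 ddA3.
rewrite /weighted /= ?(A0, dA0, ddA0, A1, dA1, ddA1, A2, dA2, ddA2, A3, dA3, ddA3).
by rewrite /l {l}; split; field.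
Qed.

Lemma rwd_covariants q :
  [/\ rwd q (cA 3), rwd q cDA3, rwd q cA3D2A3, rwd q cPhi3 & rwd q cPhi5].
Proof.
have A k : rwd q (cA k) by case: (rwd_coord k q).
have dA k : rwd q (cdA k) by case: (rwd_coord k q).
have ddA k : rwd q (cddA k) by case: (rwd_coord k q).
by split; repeat first [exact: A | exact: dA | exact: ddA | split].
Qed.

Definition inv_DA3 := (cDA3 / cA 3)%RE.
Definition inv_D2A3 := (cA3D2A3 / cA 3 ^+ 2)%RE.
Definition inv_Phi3 := (cPhi3 ^+ 2 / cA 3 ^+ 3)%RE.
Definition inv_Liouville := (cPhi3 ^+ 5 / cPhi5 ^+ 3)%RE.

(** The list has three entries, so index 3 falls through to the default, the Liouville invariant. *)
Definition invariant (i : 'I_4) : rexpr :=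
  nth inv_Liouville [:: inv_DA3; inv_D2A3; inv_Phi3] i.

(** A_3 and Phi_5 occur in denominators; Phi_3 != 0 keeps the powers of Phi_3 from degenerating in
    the Jacobian. *)
Definition generic_locus : set (T2V R) :=
  [set q | [/\ reval (cA 3) q != 0, reval cPhi3 q != 0 & reval cPhi5 q != 0]].

Lemma rwd_div q (P Q : @rexpr R (T2V R)) :
  rwd q P -> rwd q Q -> reval Q q != 0 -> rwd q (P / Q)%RE.
Proof. by move=> wP wQ Q0; split=> //; split. Qed.

Lemma reval_pow_neq0 q (P : @rexpr R (T2V R)) n : reval P q != 0 -> reval (P ^+ n)%RE q != 0.
Proof. by move=> P0; rewrite reval_pow expf_neq0. Qed.

Lemma rwd_invariant q i : generic_locus q -> rwd q (invariant i).
Proof.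
move=> [A0 P0 Q0]; have [wA wE wF w3 w5] := rwd_covariants q.
move: i; apply: forall_ord4; apply: rwd_div => //;
  by [exact: rwd_pow | exact: reval_pow_neq0].
Qed.

Lemma open_neq0 (P : @rexpr R (T2V R)) : (forall q, rwd q P) -> open [set q | reval P q != 0].
Proof.
move=> wP; apply: (@open_comp _ _ (reval P) [set x | x != 0]); last exact: open_neq.
by move=> q _; apply: differentiable_continuous; case: (is_diff_reval q P (wP q)).
Qed.

Lemma open_generic_locus : open generic_locus.
Proof.
have -> : generic_locus = [set q | reval (cA 3) q != 0] `&`
    ([set q | reval cPhi3 q != 0] `&` [set q | reval cPhi5 q != 0]).
  by apply/seteqP; split=> q; [move=> []|move=> [? []]].
by apply: openI; [|apply: openI]; apply: open_neq0 => q; case: (rwd_covariants q).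
Qed.

(** Numerator and denominator have the same weight in each case: 2, 4, 6 and 15 in the order of the
    indices. *)
Lemma invariant_first_integral (v : T2V R -> T2V R) i : characterising_field v ->
  first_integral generic_locus v (reval (invariant i)).
Proof.
move=> /characterising_fieldE[L0 [L1 [L2 [L3 [[W0 W1 W2 W3] ->]]]]] q Uq.
rewrite derive_reval; last exact: rwd_invariant.
have [A0 P0 Q0] := Uq.
have [wA wE wF w3 w5] := gauge_weights L0 L1 L2 L3 q W0 W1 W2 W3.
move: i; apply: forall_ord4.
- exact: weighted_div A0 wE wA.
- apply: (@weighted_div _ _ _ _ (4 * - L0 0 1)) => //; first exact: reval_pow_neq0.
  by have := weighted_pow _ _ _ _ 2 wA; congr weighted; ring.
- have := weighted_pow _ _ _ _ 2 w3; have := weighted_pow _ _ _ _ 3 wA.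
  rewrite (_ : 2 * (3 * _) = 3 * (2 * - L0 0 1)); last by ring.
  by move=> ? ?; apply: weighted_div => //; [exact: reval_pow_neq0|eassumption|eassumption].
- have := weighted_pow _ _ _ _ 5 w3; have := weighted_pow _ _ _ _ 3 w5.
  rewrite (_ : 5 * (3 * _) = 3 * (5 * - L0 0 1)); last by ring.
  by move=> ? ?; apply: weighted_div => //; [exact: reval_pow_neq0|eassumption|eassumption].
Qed.

End Covariants.

(** * Functional independence and density of the generic locus *)

Section Final.
Context {R : realType}.
Implicit Types (X : Vabel R) (p q v : T2V R).

Definition dirA (k : 'I_4) : T2V R := (delta_mx 0 k, 0, 0).
Definition dirdA (k : 'I_4) : T2V R := (0, delta_mx 0 k, 0).

(** These are the entries that make the Jacobian triangular. Among the covariants, A_0' enters only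
    Phi_5, A_0 only Phi_3 and Phi_5, and A_1' only A_3 D^2 A_3 and Phi_5; A_1 enters D A_3 with
    slope 2 A_3. *)
Lemma covariant_partials q :
  [/\ [/\ reval (rder (dirdA 0) cDA3) q = 0, reval (rder (dirdA 0) cA3D2A3) q = 0,
          reval (rder (dirdA 0) (cA 3)) q = 0, reval (rder (dirdA 0) cPhi3) q = 0 &
          reval (rder (dirdA 0) cPhi5) q = 3 * q.1.1 0 3 ^+ 3],
      [/\ reval (rder (dirA 0) cDA3) q = 0, reval (rder (dirA 0) cA3D2A3) q = 0,
          reval (rder (dirA 0) (cA 3)) q = 0 &
          reval (rder (dirA 0) cPhi3) q = - (3 * q.1.1 0 3 ^+ 2)],
      [/\ reval (rder (dirdA 1) cDA3) q = 0, reval (rder (dirdA 1) (cA 3)) q = 0 &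
          reval (rder (dirdA 1) cA3D2A3) q = 2 * q.1.1 0 3 ^+ 2] &
      reval (rder (dirA 1) (cA 3)) q = 0 /\
          reval (rder (dirA 1) cDA3) q = 2 * q.1.1 0 3].
Proof. by rewrite /= !mxE /=; do !split; ring. Qed.

Lemma rder_pow0 v q (P : @rexpr R (T2V R)) n :
  reval (rder v P) q = 0 -> reval (rder v (P ^+ n)%RE) q = 0.
Proof. by move=> P0; rewrite rder_pow P0 mulr0. Qed.

Lemma rder_div0 v q (P Q : @rexpr R (T2V R)) : reval Q q != 0 ->
  reval (rder v P) q = 0 -> reval (rder v Q) q = 0 -> reval (rder v (P / Q)%RE) q = 0.
Proof. by move=> Q0 P0 Q1; rewrite rder_div // P0 Q1 mul0r mulr0 subr0 mul0r. Qed.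

Lemma rder_div_num v q (P Q : @rexpr R (T2V R)) : reval Q q != 0 ->
  reval (rder v P) q != 0 -> reval (rder v Q) q = 0 -> reval (rder v (P / Q)%RE) q != 0.
Proof.
move=> Q0 P0 Q1; rewrite rder_div // Q1 mulr0 subr0.
by rewrite mulf_neq0 ?invr_eq0 ?expf_neq0 ?mulf_neq0.
Qed.

Lemma rder_div_den v q (P Q : @rexpr R (T2V R)) : reval Q q != 0 -> reval P q != 0 ->
  reval (rder v P) q = 0 -> reval (rder v Q) q != 0 -> reval (rder v (P / Q)%RE) q != 0.
Proof.
move=> Q0 P0 P1 Q1; rewrite rder_div // P1 mul0r sub0r.
by rewrite mulf_neq0 ?oppr_eq0 ?invr_eq0 ?expf_neq0 ?mulf_neq0.
Qed.

Lemma rder_pow_neq0 v q (P : @rexpr R (T2V R)) n : reval P q != 0 ->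
  reval (rder v P) q != 0 -> reval (rder v (P ^+ n.+1)%RE) q != 0.
Proof. by move=> P0 P1; rewrite rder_pow !mulf_neq0 ?expf_neq0 ?pnatr_eq0. Qed.

(* The Jacobian is triangular along the directions A_0', A_0, A_1', A_1. *)
Lemma invariant_independent :
  @functionally_independent R 4 generic_locus (fun i => reval (invariant i)).
Proof.
move=> q Uq c sum0.
have {}sum0 v : \sum_(i < 4) c i * reval (rder v (invariant i)) q = 0.
  apply: etrans (sum0 v); apply: eq_bigr => i _; congr (_ * _).
  by rewrite (@diff_val _ _ _ _ _ _ _ (is_diff_reval q _ (rwd_invariant q i Uq))).
have [A0 P0 Q0] := Uq.
have a0 : q.1.1 0 3 != 0 by [].
have [[E1 F1 A1 p1 f1] [E2 F2 A2 p2] [E3 A3 F3] [A4 E4]] := covariant_partials q.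
have nA n : reval (cA 3 ^+ n)%RE q != 0 by exact: reval_pow_neq0.
have n3 : reval (cPhi5 ^+ 3)%RE q != 0 by exact: reval_pow_neq0.
have c3 : c 3 = 0.
  move: (sum0 (dirdA 0)); rewrite big_ord4.
  rewrite (rder_div0 _ _ _ _ A0 E1 A1) (rder_div0 _ _ _ _ (nA 2) F1 (rder_pow0 _ _ _ 2 A1)).
  rewrite (rder_div0 _ _ _ _ (nA 3) (rder_pow0 _ _ _ 2 p1) (rder_pow0 _ _ _ 3 A1)).
  rewrite !mulr0 !add0r => /eqP; rewrite mulf_eq0 => /orP[/eqP //|].
  rewrite (negbTE (rder_div_den _ _ _ _ n3 _ (rder_pow0 _ _ _ 5 p1) _)) //.
    exact: reval_pow_neq0.
  by apply: rder_pow_neq0 => //; rewrite f1 mulf_neq0 ?expf_neq0 ?pnatr_eq0.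
have c2 : c 2 = 0.
  move: (sum0 (dirA 0)); rewrite big_ord4 c3 mul0r addr0.
  rewrite (rder_div0 _ _ _ _ A0 E2 A2) (rder_div0 _ _ _ _ (nA 2) F2 (rder_pow0 _ _ _ 2 A2)).
  rewrite !mulr0 !add0r => /eqP; rewrite mulf_eq0 => /orP[/eqP //|].
  rewrite (negbTE (rder_div_num _ _ _ _ (nA 3) _ (rder_pow0 _ _ _ 3 A2))) //.
  by apply: rder_pow_neq0 => //; rewrite p2 oppr_eq0 mulf_neq0 ?expf_neq0 ?pnatr_eq0.
have c1 : c 1 = 0.
  move: (sum0 (dirdA 1)); rewrite big_ord4 c3 c2 !mul0r !addr0.
  rewrite (rder_div0 _ _ _ _ A0 E3 A3).
  rewrite !mulr0 !add0r => /eqP; rewrite mulf_eq0 => /orP[/eqP //|].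
  rewrite (negbTE (rder_div_num _ _ _ _ (nA 2) _ (rder_pow0 _ _ _ 2 A3))) //.
  by rewrite F3 mulf_neq0 ?expf_neq0 ?pnatr_eq0.
have c0 : c 0 = 0.
  move: (sum0 (dirA 1)); rewrite big_ord4 c3 c2 c1 !mul0r !addr0.
  move=> /eqP; rewrite mulf_eq0 => /orP[/eqP //|].
  rewrite (negbTE (rder_div_num _ _ _ _ A0 _ A4)) //.
  by rewrite E4 mulf_neq0 ?pnatr_eq0.
exact: forall_ord4.
Qed.

(** Along the line [g] is affine with nonzero slope, so it has a single zero, which an arbitrarily
    small step leaves. *)
Lemma affine_avoid0 (W : set (T2V R)) (g : T2V R -> R) p v (c : R) :
  open W -> W p -> c != 0 -> (forall s, g (p + s *: v) = g p + s * c) ->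
  exists s : R, W (p + s *: v) /\ g (p + s *: v) != 0.
Proof.
move=> oW Wp c0 gE.
have [gp0|gp0] := eqVneq (g p) 0; last first.
  by exists 0; rewrite gE scale0r mul0r !addr0.
have ct : {for 0, continuous (fun s : R => p + s *: v)}.
  apply: continuousD; first exact: cst_continuous.
  exact: scalel_continuous.
have Wn : nbhs (p + (0 : R) *: v) W.
  by rewrite scale0r addr0; apply: open_nbhs_nbhs.
have /nbhs_ballP[e /= e0 be] := ct _ Wn.
(* Half the radius is nonzero and stays strictly inside the ball. *)
exists (e / 2); rewrite gE gp0 add0r.
split; last by rewrite mulf_neq0 // lt0r_neq0 // divr_gt0.
apply: be; rewrite /ball /= sub0r normrN gtr0_norm ?divr_gt0 //.
by rewrite ltr_pdivrMr // ltr_pMr // ltr1n.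
Qed.

(** Three successive small moves, along A_3, A_0 and A_0', make A_3, Phi_3 and Phi_5 nonzero in
    turn. Phi_3 is affine in A_0 with slope -3 A_3^2, and Phi_5 is affine in A_0' with slope 3
    A_3^3. The later moves do not change the quantities already made nonzero. *)
Lemma dense_generic_locus : dense (@generic_locus R).
Proof.
move=> W [p Wp] oW.
have [s1 [W1 n1]] := @affine_avoid0 W (reval (cA 3)) p (dirA 3) 1 oW Wp (oner_neq0 _)
  ltac:(by move=> s; rewrite /= !mxE /=; ring).
set p1 := p + s1 *: dirA 3 in W1 n1.
have c2 : - (3 * p1.1.1 0 3 ^+ 2) != 0.
  by rewrite oppr_eq0 mulf_neq0 ?expf_neq0 ?pnatr_eq0.
have [s2 [W2 n2]] := @affine_avoid0 W (reval cPhi3) p1 (dirA 0) _ oW W1 c2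
  ltac:(by move=> s; rewrite /= !mxE /=; ring).
set p2 := p1 + s2 *: dirA 0 in W2 n2.
have A2 : p2.1.1 0 3 = p1.1.1 0 3 by rewrite /= !mxE /=; ring.
have c3 : 3 * p2.1.1 0 3 ^+ 3 != 0.
  by rewrite A2 mulf_neq0 ?expf_neq0 ?pnatr_eq0.
have [s3 [W3 n3]] := @affine_avoid0 W (reval cPhi5) p2 (dirdA 0) _ oW W2 c3
  ltac:(by move=> s; rewrite /= !mxE /=; ring).
exists (p2 + s3 *: dirdA 0); split=> //; split=> //.
- rewrite (_ : reval _ _ = p1.1.1 0 3) // -A2 /= !mxE /=; ring.
- rewrite (_ : reval _ _ = reval cPhi3 p2) // /= !mxE /=; ring.
Qed.

(** * The Liouville invariant along a curve *)

Lemma coefA_derive1 (Z : R -> Vabel R) k s : derivable Z s 1 ->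
  (coefA Z k)^`()%classic s = Z^`()%classic s 0 k.
Proof. by move=> dZ; rewrite !derive1E derive_mx // mxE. Qed.

(** Phi_3 does not involve X'', so the last slot is filled with 0; differentiating this lift then
    calls for no third derivative of X. *)
Lemma Phi3_jet (X : R -> Vabel R) : smooth_curve X ->
  Phi3 X = reval cPhi3 \o (fun s => (X s, X^`()%classic s, 0) : T2V R).
Proof.
move=> sX.
apply/funext => s; rewrite /Phi3 /= !coefA_derive1; try exact: (sX 0).
by rewrite /coefA; ring.
Qed.

(** Chain rule along the lift (X, X', 0), whose velocity is (X', X'', 0). *)
Lemma derive1_Phi3 (X : R -> Vabel R) t : smooth_curve X ->
  (Phi3 X)^`()%classic t = reval cdPhi3 (jet2 X t).
Proof.
move=> sX; pose X1 := X^`()%classic; pose X2 := X^`(2)%classic.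
have dX : differentiable X t by apply/derivable1_diffP; exact: (sX 0).
have dX1 : differentiable X1 t by apply/derivable1_diffP; exact: (sX 1).
pose Y := fun s => (X s, X1 s).
have dY : differentiable Y t by exact: differentiable_pair.
have d0 : differentiable (fun=> 0 : Vabel R) t by exact: differentiable_cst.
have dZ := differentiable_pair dY d0.
have [_ _ _ w3 _] := rwd_covariants (X t, X1 t, 0).
have [d3 d3E] := is_diff_reval _ _ w3.
rewrite Phi3_jet // derive1E deriveE; last exact: differentiable_comp.
rewrite diff_comp //= d3E.
have -> : 'd (fun s => (X s, X1 s, 0) : T2V R) t 1 = (X1 t, X2 t, 0).
  apply: etrans (congr1 (@^~ (1 : R)) (diff_pair dY d0)) _.
  apply: f_equal2; last by rewrite diff_cst.
  apply: etrans (congr1 (@^~ (1 : R)) (diff_pair dX dX1)) _.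
  apply: f_equal2.
    exact: etrans (esym (deriveE _ dX)) (esym (derive1E X t)).
  exact: etrans (esym (deriveE _ dX1)) (esym (derive1E X1 t)).
by rewrite /= /jet2 /= -/X1 -/X2; field.
Qed.

Lemma Phi3E (X : R -> Vabel R) t : smooth_curve X ->
  Phi3 X t = reval cPhi3 (jet2 X t).
Proof. by move=> sX; rewrite Phi3_jet. Qed.

Lemma Phi5E (X : R -> Vabel R) t : smooth_curve X ->
  Phi5 X t = reval cPhi5 (jet2 X t).
Proof.
move=> sX; rewrite /Phi5 derive1_Phi3 // Phi3E // coefA_derive1; last exact: (sX 0).
rewrite /coefA /=; ring.
Qed.

Lemma represents_Liouville_inv :
  represents_Liouville generic_locus (reval (@inv_Liouville R)).
Proof.
move=> X t sX [_ _ P5]; rewrite Phi5E // Phi3E //; split=> //.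
rewrite -[LHS]/(reval (cPhi3 ^+ 5)%RE _ / reval (cPhi5 ^+ 3)%RE _).
by rewrite !reval_pow.
Qed.

End Final.

Theorem mainTheorem14 (R : realType) :
  exists U : set (T2V R),
    [/\ open U, dense U &
      forall p : T2V R, U p ->
        exists (O : set (T2V R)) (f : 'I_4 -> T2V R -> R),
          [/\ open O, O p,
              (forall i : 'I_4, local_quasi_Lie_invariant2 O (f i)),
              functionally_independent O f &
              exists i : 'I_4, represents_Liouville O (f i)]].
Proof.
have oU := @open_generic_locus R.
exists generic_locus; split=> [//||p Up]; first exact: dense_generic_locus.
(* The invariants are defined on the whole locus, which thus serves as the neighbourhood [O] of
   every [p]. *)
exists generic_locus, (fun i => reval (invariant i)); split=> //.
- move=> i; split; last by move=> v cv; exact: invariant_first_integral.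
  by apply: smooth_on_reval => // q Uq; exact: rwd_invariant.
- exact: invariant_independent.
- by exists 3; exact: represents_Liouville_inv.
Qed.
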